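(* Let $r>1$ be an integer, and let $A_i,C_i\in\mathbb{C}^{m\times m}$ and $B_i,D_i\in\mathbb{C}^{n\times n}$ for $i=1,\dots,r$. The system of matrix equations $$\left\{\begin{array}{ll} A_iX_iB_i-C_iX_{i+1}D_i=0, & i=1,\dots,r-1,\\ A_rX_rB_r-C_rX_1D_r=0,\end{array}\right.$$ in the unknowns $X_1,\dots,X_r\in\mathbb{C}^{m\times n}$ has only the trivial solution $X_1=\cdots=X_r=0$ if and only if the two matrix pencils (in the variable $\lambda$) $$\begin{bmatrix} \lambda C_r & A_r & & \\ & \lambda C_{r-1} & \ddots & \\ & & \ddots & A_2 \\ A_1 & & & \lambda C_1 \end{bmatrix}\quad\text{and}\quad\begin{bmatrix} \lambda B_r & D_{r-1} & & \\ & \lambda B_{r-1} & \ddots & \\ & & \ddots & D_1 \\ D_r & & & \lambda B_1 \end{bmatrix}$$ are both regular and have disjoint spectra. Here the first pencil is the $r\times r$ block matrix with diagonal blocks $\lambda C_r,\lambda C_{r-1},\dots,\lambda C_1$ (top to bottom), block superdiagonal $A_r,A_{r-1},\dots,A_2$, bottom-left block $A_1$, and all other blocks zero. The second is the $r\times r$ block matrix with diagonal blocks $\lambda B_r,\lambda B_{r-1},\dots,\lambda B_1$, block superdiagonal $D_{r-1},D_{r-2},\dots,D_1$, bottom-left block $D_r$, and all other blocks zero.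
   Context: A matrix pencil $M+\lambda N$ (with $M,N$ complex matrices of the same size) is regular if $M,N$ are square and $\det(M+\lambda N)$ is not identically zero as a polynomial in $\lambda$. For a regular pencil, $\lambda_0\in\mathbb{C}$ is a (finite) eigenvalue if $\det(M+\lambda_0N)=0$, and $\infty$ is an eigenvalue if $N$ is not invertible. The spectrum of a regular pencil is the set of all its eigenvalues, a subset of $\mathbb{C}\cup\{\infty\}$ (so disjointness of spectra also requires that $\infty$ is not a common eigenvalue). *)

(* Defs.v *)
From HB Require Import structures.
From mathcomp Require Import all_boot all_order all_algebra.
From mathcomp Require Import complex.
From mathcomp Require Import boolp classical_sets reals.

Set Implicit Arguments.
Unset Strict Implicit.
Unset Printing Implicit Defensive.

Import GRing.Theory.
Local Open Scope ring_scope.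
Local Open Scope classical_set_scope.

(* The square matrix pencil M + lambda N, with M = pconst and N = plin. *)
Record pencil (K : fieldType) (p : nat) := Pencil {
  pconst : 'M[K]_p;
  plin : 'M[K]_p
}.

Definition pencil_mx (K : fieldType) (p : nat) (P : pencil K p) :
    'M[{poly K}]_p :=
  map_mx polyC (pconst P) + 'X *: map_mx polyC (plin P).

Definition regular (K : fieldType) (p : nat) (P : pencil K p) : Prop :=
  \det (pencil_mx P) <> 0.

(* [Some l] is the finite point l and [None] the point at infinity. The value
   is only meaningful for a regular pencil. *)
Definition spectrum (K : fieldType) (p : nat) (P : pencil K p) :
    set (option K) :=
  [set z | match z with
           | Some l => \det (pconst P + l *: plin P) = 0
           | None => plin P \notin unitmx
           end].

(* Families are indexed from 0: [A i] stands for A_(i+1), so that [A (rev_ord i)]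
   is A_(r-i). The successor [ordS] is cyclic: it sends r-1 to 0, which gives the
   last equation A_r X_r B_r - C_r X_1 D_r = 0 below, and the block positions
   (i, ordS i) are the superdiagonal together with the bottom-left corner. *)

Definition sylvester_cycle (K : fieldType) (r m n : nat)
    (A C : 'I_r -> 'M[K]_m) (B D : 'I_r -> 'M[K]_n)
    (X : 'I_r -> 'M[K]_(m, n)) : Prop :=
  forall i : 'I_r,
    A i *m X i *m B i - C i *m X (ordS i) *m D i = 0.

Definition left_pencil (K : fieldType) (r m : nat) (A C : 'I_r -> 'M[K]_m) :
    pencil K (\sum_(i < r) m) :=
  Pencil
    (\mxblock_(i < r, j < r) (if j == ordS i then A (rev_ord i) else 0))
    (\mxdiag_(i < r) C (rev_ord i)).

(* [D (rev_ord j)] with j = ordS i is D_(r-1-i) on the superdiagonal (i < r-1)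
   and D_r in the corner (j = 0). *)
Definition right_pencil (K : fieldType) (r n : nat) (B D : 'I_r -> 'M[K]_n) :
    pencil K (\sum_(i < r) n) :=
  Pencil
    (\mxblock_(i < r, j < r) (if j == ordS i then D (rev_ord j) else 0))
    (\mxdiag_(i < r) B (rev_ord i)).

(* Main.v *)
(* If both pencils are regular with disjoint spectra, a solution of the cyclic
   system fills the blocks (ordS j, j) of a matrix Y with P Y T = Q Y S, where
   P + lambda Q and S + lambda T are the two pencils. For mu outside both spectra,
   (P + mu Q)^-1 Q and T (S + mu T)^-1 are then intertwined by Y without a common
   eigenvalue, so Y = 0.

   Conversely, a singular left pencil has a polynomial kernel vector. Since the
   pencil is block cyclic, one homogeneous piece of it is a chain: a finitely
   supported sequence z_t of vectors with A_t z_t + C_t z_(t+1) = 0, indices of the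
   coefficients being read mod r. In a chain of minimal length the z_t with t in one
   residue class are linearly independent, so summing z_t y_t over residue classes,
   for a nonzero sequence y of rows with y_t B_t + y_(t+1) D_t = 0, gives a nonzero
   solution. Without chains, a common eigenvalue l <> 0 gives the solution x_j y_j
   built from eigenvectors; l = 0 gives a solution propagated between a singular A
   and a singular D as close as possible. Transposition exchanges the two
   pencils and the points 0 and infinity. *)

Require Import Defs.
From mathcomp Require Import all_boot all_order all_algebra.
From mathcomp Require Import complex.
From mathcomp Require Import boolp classical_sets reals.
From mathcomp Require Import zify.

Set Implicit Arguments.
Unset Strict Implicit.
Unset Printing Implicit Defensive.

Import GRing.Theory.
Local Open Scope ring_scope.
Local Open Scope classical_set_scope.

(** * Chains *)

Section Chains.
Variables (K : fieldType) (r' : nat).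
Local Notation r := r'.+1.
Local Notation pos := (@inZp r').

Lemma pos_ordS (t : nat) : ordS (pos t) = pos t.+1.
Proof. by apply: val_inj; rewrite /= -addn1 modnDml addn1. Qed.

Lemma pos_eqP (s t : nat) : reflect (s = t %[mod r]) (pos s == pos t).
Proof. by apply: (iffP eqP) => [[]//|e]; apply: val_inj. Qed.

Lemma pos_surj (i : 'I_r) : pos i = i.
Proof. exact: valZpK. Qed.

Lemma singular_col p (M : 'M[K]_p) :
  M \notin unitmx -> exists2 v : 'cV[K]_p, v != 0 & M *m v = 0.
Proof.
rewrite -unitmx_tr unitmxE unitfE negbK => /det0P[v v0 vM].
exists v^T; first by rewrite -trmx0 (inj_eq trmx_inj).
by apply: trmx_inj; rewrite trmx_mul trmxK trmx0.
Qed.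

Lemma singular_row p (M : 'M[K]_p) :
  M \notin unitmx -> exists2 v : 'rV[K]_p, v != 0 & v *m M = 0.
Proof. by rewrite unitmxE unitfE negbK => /det0P. Qed.

Section Left.
Variables (m : nat) (A C : 'I_r -> 'M[K]_m).

(** The offset [o] lets a chain begin at index 1 in any block; [L] only bounds its support. *)
Definition chain (o L : nat) (z : nat -> 'cV[K]_m) : Prop :=
  [/\ z 0%N = 0, forall t, (L < t)%N -> z t = 0 &
      forall t, A (pos (o + t)) *m z t + C (pos (o + t)) *m z t.+1 = 0].

Definition has_chain : Prop :=
  exists o L z, chain o L z /\ exists t, z t != 0.

(** A chain of least bound has [z 1 != 0]: otherwise shifting it by one, with offset [o.+1], would
    lower the bound. *)
Lemma minimal_chain : has_chain -> exists o L z,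
  [/\ (0 < L)%N, chain o L z, z 1%N != 0 &
      forall o' L' z', chain o' L' z' -> (exists t, z' t != 0) -> (L <= L')%N].
Proof.
move=> [o0 [L0 [z0 h0]]].
pose P L := `[< exists o z, chain o L z /\ exists t, z t != 0 >].
have exP : exists L, P L by exists L0; apply/asboolP; exists o0, z0.
case: (ex_minnP exP) => L /asboolP [o [z [ch [t0 zt0]]]] Lmin.
have min o' L' z' : chain o' L' z' -> (exists t, z' t != 0) -> (L <= L')%N.
  by move=> c n; apply: Lmin; apply/asboolP; exists o', z'.
case: (ch) => z_0 zL rel.
have L_gt0 : (0 < L)%N.
  rewrite lt0n; apply: contraNneq zt0 => L0'.
  by case: t0 => [|t]; [rewrite z_0 | rewrite zL ?L0'].
exists o, L, z; split=> //; apply/eqP => z1.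
suff : (L <= L.-1)%N by lia.
apply: (min o.+1 _ (fun t => z t.+1)); last first.
  by case: t0 zt0 => [|t] zt0; [rewrite z_0 eqxx in zt0 | exists t].
split=> // [t Lt | t]; first by apply: zL; lia.
by rewrite addSnnS; apply: rel.
Qed.

(* If [h] is the last index of a relation, convolving the chain with the
   relation read backwards kills the term of index [h], which leaves a shorter
   chain. Only indices congruent mod [r] may occur, since [A] and [C] are
   [r]-periodic along the chain. *)
Lemma minimal_chain_free o L z :
  chain o L z -> z 1%N != 0 ->
  (forall o' L' z', chain o' L' z' -> (exists t, z' t != 0) -> (L <= L')%N) ->
  forall (i : 'I_r) (b : nat -> K),
    (forall t, b t != 0 -> pos (o + t) = i) ->
    \sum_(t < L.+1) b t *: z t = 0 ->
    forall t, (0 < t <= L)%N -> b t = 0.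
Proof.
move=> [z0 zL rel] z1 min i b bi sum0 t1 t1L; apply/eqP/negPn/negP => bt1.
pose Q t := (0 < t <= L)%N && (b t != 0).
have exQ : exists t, Q t by exists t1; rewrite /Q t1L bt1.
have Qle t : Q t -> (t <= L)%N by case/andP=> /andP[].
case: (ex_maxnP exQ Qle) => h /andP[/andP[h0 hL] bh] hmax.
have bz t : (h < t <= L)%N -> b t = 0.
  move=> /andP[ht tL]; apply/eqP/negPn/negP => bt.
  by have := hmax t; rewrite /Q tL bt (leq_ltn_trans _ ht) // => /(_ isT); lia.
have sumh : \sum_(t < h) b (h - t)%N *: z (h - t)%N = 0.
  rewrite -[RHS]sum0 -[RHS](big_mkord xpredT (fun t => b t *: z t)).
  rewrite (@big_cat_nat _ _ _ h.+1) //= [X in _ = _ + X]big_nat_cond.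
  rewrite [X in _ = _ + X]big1 ?addr0; last first.
    by move=> t /andP[tt _]; rewrite bz ?scale0r //; lia.
  rewrite big_nat_recl // z0 scaler0 add0r big_mkord.
  rewrite (reindex_inj rev_ord_inj) /=; apply: eq_bigr => t _.
  by rewrite (_ : h - (h - t.+1) = t.+1)%N //; have := ltn_ord t; lia.
(* The convolution vanishes at [h] by [sumh], so cutting it off there preserves the recurrence. *)
pose z' t : 'cV[K]_m := if (t < h)%N then \sum_(k < h) b (h - k)%N *: z (t - k)%N else 0.
have z'E t : (t <= h)%N -> z' t = \sum_(k < h) b (h - k)%N *: z (t - k)%N.
  rewrite leq_eqVlt /z' => /orP[/eqP->|->] //.
  by rewrite ltnn -[LHS]sumh; apply: eq_bigr.
suff : (L <= h.-1)%N by lia.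
apply: (min o _ z'); last first.
  exists 1%N; rewrite z'E // (bigD1 (Ordinal h0)) //= subn0 big1 ?addr0.
    by rewrite scaler_eq0 negb_or bh.
  by case=> [[|k] kh] //= _; rewrite subSS sub0n z0 scaler0.
split=> [|t ht|t].
- by rewrite z'E // big1 // => k _; rewrite sub0n z0 scaler0.
- by rewrite /z' ifN //; lia.
have [th|ht] := ltnP t h; last first.
  by rewrite /z' !ifN ?mulmx0 ?addr0 //; lia.
rewrite (z'E t (ltnW th)) (z'E t.+1 th) !mulmx_sumr -big_split big1 //= => k _.
rewrite -!scalemxAr -scalerDr.
have [->|bhk] := eqVneq (b (h - k)%N) 0; first by rewrite scale0r.
have kh := ltn_ord k.
have [tk|kt] := ltnP t k.
  have [-> ->] : (t - k = 0)%N /\ (t.+1 - k = 0)%N by lia.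
  by rewrite z0 !mulmx0 addr0 scaler0.
(* Both [b (h - k)] and [b h] are nonzero, so [r] divides [k] and a shift by [k] keeps the
   coefficients. *)
have -> : pos (o + t) = pos (o + (t - k)).
  apply/eqP/pos_eqP.
  have /eqP/pos_eqP : pos (o + (h - k)) = pos (o + h) by rewrite !bi.
  move/eqP; rewrite eqn_modDl => e; apply/eqP; rewrite eqn_modDl.
  rewrite -(eqn_modDr (h - t)).
  by rewrite (_ : t - k + (h - t) = h - k)%N ?subnKC 1?eq_sym //; lia.
by rewrite subSn // rel scaler0.
Qed.

End Left.

(** By induction: divide by [d L.+1] when it is invertible; otherwise restart with a single nonzero
    term, a kernel row of [d L.+1], in the last position. *)
Lemma propagate_row n (b d : nat -> 'M[K]_n) (L : nat) : (0 < n)%N ->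
  exists y : nat -> 'rV[K]_n,
    (forall t, (0 < t < L.+1)%N -> y t *m b t + y t.+1 *m d t = 0) /\
    exists2 t, (0 < t <= L.+1)%N & y t != 0.
Proof.
move=> n0; elim: L => [|L [y [rel [t0 t0L yt0]]]].
  exists (fun=> const_mx 1); split=> [t|]; first by lia.
  by exists 1%N => //; apply/rV0Pn; exists (Ordinal n0); rewrite mxE oner_eq0.
have [dL|/singular_row[v v0 vd]] := boolP (d L.+1 \in unitmx); last first.
  exists (fun t => if t == L.+2 then v else 0); split=> [t tL|]; last first.
    by exists L.+2; rewrite ?eqxx //; lia.
  rewrite ifN ?mul0mx ?add0r; last by lia.
  by case: eqVneq => [[->]|]; rewrite ?mul0mx.
exists (fun t =>
  if t == L.+2 then - (y L.+1 *m b L.+1 *m invmx (d L.+1)) else y t).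
split=> [t tL|]; last by exists t0; rewrite 1?ifN //; lia.
rewrite ifN; last by lia.
case: eqVneq => [[->]|tL']; first by rewrite mulNmx mulmxKV // subrr.
by apply: rel; lia.
Qed.

(** * Solutions of the cyclic system built from chains and eigenvectors *)

Section System.
Variables (m n : nat) (A C : 'I_r -> 'M[K]_m) (B D : 'I_r -> 'M[K]_n).

Definition only_trivial : Prop :=
  forall X : 'I_r -> 'M[K]_(m, n), sylvester_cycle A C B D X -> forall i, X i = 0.

Definition wrap (o L : nat) (W : nat -> 'M[K]_(m, n)) (i : 'I_r) : 'M[K]_(m, n) :=
  \sum_(t < L.+1 | pos (o + t) == i) W t.

(** Equation [i] for the folded sequence is the sum of the relations over one residue class; the
    zero terms at 0 and [L.+1] absorb the shift of index. *)
Lemma wrap_cycle o L W :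
  W 0%N = 0 -> W L.+1 = 0 ->
  (forall t, (t <= L)%N -> A (pos (o + t)) *m W t *m B (pos (o + t)) =
             C (pos (o + t)) *m W t.+1 *m D (pos (o + t))) ->
  sylvester_cycle A C B D (wrap o L W).
Proof.
move=> W0 WL rel i; apply/eqP; rewrite subr_eq0; apply/eqP.
have -> : wrap o L W (ordS i) = \sum_(t < L.+1 | pos (o + t) == i) W t.+1.
  rewrite /wrap -(big_mkord (fun t => pos (o + t) == ordS i)).
  rewrite -(big_mkord (fun t => pos (o + t) == i) (fun t => W t.+1)).
  rewrite [LHS]big_mkcond [RHS]big_mkcond big_nat_recl // big_nat_recr //=.
  rewrite W0 WL !if_same add0r addr0; apply: eq_bigr => t _.
  by rewrite addnS -pos_ordS (inj_eq (@ordS_inj _)).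
rewrite /wrap !mulmx_sumr !mulmx_suml; apply: eq_bigr => t /eqP <-.
by rewrite rel // -ltnS.
Qed.

Lemma chain_nontrivial : (0 < n)%N -> has_chain A C -> ~ only_trivial.
Proof.
move=> n0 /minimal_chain[o [L [z [L0 ch z1 min]]]] triv.
case: (ch) => z0 zL rel.
case: L L0 zL ch min => // L _ zL ch min.
have [y [yrel [t0 t0L yt0]]] :=
  propagate_row (fun t => B (pos (o + t))) (fun t => D (pos (o + t))) L n0.
have relN t : A (pos (o + t)) *m z t = - (C (pos (o + t)) *m z t.+1).
  by apply/eqP; rewrite -addr_eq0 rel.
have /triv X0 : sylvester_cycle A C B D (wrap o L.+1 (fun t => z t *m y t)).
  (* At the two ends the chain alone gives [C z_1 = 0] and [A z_(L+1) = 0]; in between, the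
     recurrences of [z] and [y] combine and their signs cancel. *)
  apply: wrap_cycle => [||t tL]; first by rewrite z0 mul0mx.
    by rewrite zL ?mul0mx.
  have [->|t_gt0] := posnP t.
    have /eqP := rel 0%N; rewrite z0 mulmx0 add0r => /eqP e.
    by rewrite mul0mx mulmx0 mul0mx mulmxA e !mul0mx.
  move: tL; rewrite leq_eqVlt => /orP[/eqP->|tL].
    rewrite [z L.+2]zL // mul0mx mulmx0 mul0mx mulmxA relN zL //.
    by rewrite mulmx0 oppr0 !mul0mx.
  rewrite !mulmxA relN !mulNmx -!mulmxA -!mulmxN; do 2!congr (_ *m _).
  by apply/eqP; rewrite mulmxN eq_sym -addr_eq0 addrC yrel // t_gt0 tL.
have [q yq] := rV0Pn _ yt0.
(* Column [q] of the block [pos (o + t0)] is a relation among the [z t] of one residue class, with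
   coefficient [y t0 0 q] at [t0]. *)
pose b t := if pos (o + t) == pos (o + t0) then y t 0 q else 0.
have /negP[] := yq; apply/eqP.
have := minimal_chain_free ch z1 min (i := pos (o + t0)) (b := b) _ _ t0L.
rewrite /b eqxx; apply => [t|]; first by case: (pos _ =P _) => // _; rewrite eqxx.
transitivity (col q (wrap o L.+1 (fun t => z t *m y t) (pos (o + t0)))).
  rewrite /wrap linear_sum [RHS]big_mkcond.
  apply: eq_bigr => t _; case: ifP => _; last by rewrite scale0r.
  by apply/colP => k; rewrite !mxE big_ord1 mulrC.
by rewrite X0 linear0.
Qed.

(** The products [x j *m y j] solve the system, so [x j = 0] wherever [y j != 0]; cutting the cycle
    at such a [j] and scaling by [l ^+ t] gives a chain. *)
Lemma common_eigenvalue_chain (l : K) (x : 'I_r -> 'cV[K]_m) (y : 'I_r -> 'rV[K]_n) :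
  only_trivial -> l != 0 ->
  (forall j, A j *m x j + l *: (C j *m x (ordS j)) = 0) ->
  (forall j, y (ordS j) *m D j + l *: (y j *m B j) = 0) ->
  (exists i, x i != 0) -> (exists j, y j != 0) -> has_chain A C.
Proof.
move=> triv l0 xP yP [i xi] [j yj].
have /triv X0 : sylvester_cycle A C B D (fun j => x j *m y j).
  move=> k; have /eqP := xP k; rewrite addr_eq0 => /eqP xk.
  have /eqP := yP k; rewrite addr_eq0 => /eqP yk.
  rewrite !mulmxA xk -[X in _ - X]mulmxA yk mulmxN opprK !mulNmx.
  by rewrite -!scalemxAl -!scalemxAr !mulmxA addNr.
have xj : x j = 0.
  apply/eqP/negPn/negP => /matrix0Pn[a [e xa]]; have [q yq] := rV0Pn _ yj.
  have /matrixP/(_ a q) := X0 j; rewrite !mxE big_ord1 (ord1 e) in xa *.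
  by move/eqP; rewrite mulf_eq0 (negPf xa) (negPf yq).
exists j, r, (fun t => if (t < r)%N then l ^+ t *: x (pos (j + t)) else 0).
have xr : x (pos (j + r)) = 0.
  by rewrite (_ : pos _ = j) //; apply: val_inj; rewrite /= modnDr modn_small.
split.
  split=> [|t rt|t]; first by rewrite addn0 pos_surj xj scaler0.
    by rewrite ifN //; lia.
  case: ltngtP => [tr|tr|tr]; last first.
  - by rewrite ifN ?mulmx0 ?addr0 //; lia.
  - by rewrite ifN ?mulmx0 ?addr0 //; lia.
  have -> : (if (t.+1 < r)%N then l ^+ t.+1 *: x (pos (j + t.+1)) else 0) =
            l ^+ t.+1 *: x (pos (j + t.+1)).
    case: ifP => // tr'; have <- : r = t.+1 by lia.
    by rewrite xr scaler0.
  rewrite addnS -pos_ordS exprSr -scalerA -!scalemxAr -scalerDr.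
  by rewrite xP scaler0.
exists ((i + (r - j)) %% r)%N.
rewrite ltn_pmod // scaler_eq0 expf_eq0 (negPf l0) andbF /=.
rewrite (_ : pos _ = i) //; apply: val_inj => /=.
rewrite modnDmr addnCA subnKC 1?ltnW //.
by rewrite modnDr modn_small.
Qed.

(** The solution built here must vanish, which forces [z 1 = 0]; what was propagated from the kernel
    of a singular [A] is then itself a chain, nonzero at its last term. *)
Lemma common_zero_chain (a d : 'I_r) :
  only_trivial -> A a \notin unitmx -> D d \notin unitmx -> has_chain A C.
Proof.
move=> triv Aa Dd.
pose P e := [exists d : 'I_r, (D d \notin unitmx) && (A (pos (d + e.+1)) \notin unitmx)].
have exP : exists e, P e.
  exists (a + (r - d.+1))%N; apply/existsP; exists d.
  rewrite Dd (_ : pos _ = a) //; apply: val_inj => /=.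
  have -> : (d + (a + (r - d.+1)).+1 = a + r)%N by have := ltn_ord d; lia.
  by rewrite modnDr modn_small.
have [e /existsP[{Dd}{}d /andP[Dd Ae]] emin] := ex_minnP exP.
have er : (e < r)%N.
  rewrite ltnNge; apply/negP => re.
  suff /emin : P (e - r)%N by lia.
  apply/existsP; exists d; rewrite Dd (_ : pos _ = pos (d + e.+1)) //.
  apply/eqP/pos_eqP; rewrite -modnDr; congr (_ %% _)%N; lia.
have Ainv t : (0 < t <= e)%N -> A (pos (d + t)) \in unitmx.
  move=> te; apply/negPn/negP => At; suff /emin : P t.-1 by lia.
  by apply/existsP; exists d; rewrite Dd prednK //; lia.
have Dinv t : (0 < t <= e)%N -> D (pos (d + t)) \in unitmx.
  move=> te; apply/negPn/negP => Dt; suff /emin : P (e - t)%N by lia.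
  apply/existsP; exists (pos (d + t)); rewrite Dt.
  rewrite (_ : pos (pos (d + t) + _) = pos (d + e.+1)) //.
  apply/eqP/pos_eqP => /=; rewrite modnDml; congr (_ %% _)%N; lia.
have [u u0 Au] := singular_col Ae; have [v v0 vD] := singular_row Dd.
(* By minimality of the gap [e], all [A] and [D] strictly in between are
   invertible: [z] can be propagated downwards from the kernel of the singular
   [A], [y] upwards from that of the singular [D]. *)
pose zr := fix zr k := if k is k'.+1 then
  - (invmx (A (pos (d + (e - k')))) *m (C (pos (d + (e - k'))) *m zr k')) else u.
pose z t := if (t <= e.+1)%N then zr (e.+1 - t)%N else 0.
pose y := fix y t := if t is (t'.+1 as t1).+1 then
  - (y t1 *m B (pos (d + t1)) *m invmx (D (pos (d + t1)))) else v.
have zrel t : (0 < t)%N -> A (pos (d + t)) *m z t + C (pos (d + t)) *m z t.+1 = 0.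
  move=> t0; have [te|te|->] := ltngtP t e.+1.
  - rewrite /z te ltnW // subSn; last by lia.
    rewrite /= subKn //.
    by rewrite mulmxN mulKVmx ?addNr // Ainv // t0.
  - by rewrite /z !ifN ?mulmx0 ?addr0 //; lia.
  - by rewrite /z leqnn ltnn subnn Au mulmx0 addr0.
have yrel t : (0 < t <= e)%N -> y t *m B (pos (d + t)) + y t.+1 *m D (pos (d + t)) = 0.
  by case: t => // t te; rewrite /= mulNmx mulmxKV ?subrr // Dinv.
(* At 0 the value is set to 0: the relation there holds because [y 1 = v] is killed by [D d]. *)
pose W t := if t is 0%N then 0 else z t *m y t.
have /triv X0 : sylvester_cycle A C B D (wrap d e.+1 W).
  apply: wrap_cycle => // [|[|t] tL].
  - by rewrite /W /z ltnn mul0mx.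
  - by rewrite /W mulmx0 mul0mx addn0 pos_surj -!mulmxA [y 1%N *m _]vD !mulmx0.
  rewrite /W !mulmxA.
  have /eqP := zrel t.+1 isT; rewrite addr_eq0 => /eqP ->.
  move: tL; rewrite leq_eqVlt => /orP[/eqP[->]|tL].
    by rewrite /z ltnn mulmx0 oppr0 !mul0mx.
  rewrite !mulNmx -!mulmxA -!mulmxN; do 2!congr (_ *m _).
  by apply/eqP; rewrite mulmxN eq_sym -addr_eq0 addrC yrel.
(* As [e < r], the indices from 1 to [e.+1] lie in distinct residue classes, so a single product
   survives. *)
have X1 : wrap d e.+1 W (pos (d + 1)) = z 1%N *m v.
  have lt1 : (1 < e.+2)%N by [].
  rewrite /wrap (bigD1 (Ordinal lt1)) //= big1 ?addr0 // => -[[|t] tL] //.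
  case/andP=> /pos_eqP/eqP; rewrite eqn_modDl /= => tr /negP[].
  apply/eqP/val_inj => /=; move: tr; rewrite -add1n -[X in _ == X %[mod _]]addn0.
  by rewrite eqn_modDl mod0n modn_small ?(leq_trans _ er) // => /eqP ->.
have z1 : z 1%N = 0.
  apply/eqP/negPn/negP => /matrix0Pn[i [k zi]]; have [q vq] := rV0Pn _ v0.
  have /matrixP/(_ i q) := X0 (pos (d + 1)); rewrite X1 !mxE big_ord1 (ord1 k) in zi *.
  by move/eqP; rewrite mulf_eq0 (negPf zi) (negPf vq).
exists d.+1, e, (fun t => z t.+1); split.
  split=> // [t et|t]; first by rewrite /z ifN //; lia.
  by rewrite addSnnS; apply: zrel.
by exists e; rewrite /z leqnn subnn.
Qed.

End System.

End Chains.

(** * Kernels of block cyclic pencils *)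

Lemma ordS_rev r (i : 'I_r) : ordS (rev_ord (ordS i)) = rev_ord i.
Proof.
apply: val_inj => /=; have ir := ltn_ord i.
have [e|ne] := eqVneq i.+1 r; first by rewrite e modnn subn1 prednK ?modnn; lia.
by rewrite [(i.+1 %% r)%N]modn_small ?modn_small; lia.
Qed.

Lemma submxcolZ (S : pzSemiRingType) r (p_ : 'I_r -> nat) n (a : S)
    (M : 'M[S]_(\sum_i p_ i, n)) i : submxcol (a *: M) i = a *: submxcol M i.
Proof. by apply/matrixP => ? ?; rewrite !mxE. Qed.

Lemma submxrowZ (S : pzSemiRingType) r (p_ : 'I_r -> nat) n (a : S)
    (M : 'M[S]_(n, \sum_i p_ i)) i : submxrow (a *: M) i = a *: submxrow M i.
Proof. by apply/matrixP => ? ?; rewrite !mxE. Qed.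

Section Kernels.
Variables (S : idomainType) (r m : nat) (k l : S) (A C : 'I_r -> 'M[S]_m).

(** The homogeneous coefficients [k], [l] cover the finite points [(1, l)], infinity [(0, 1)] and,
    over polynomials, the pencil itself [(1, 'X)]. *)
Lemma cyclic_col_kernel :
  \det (k *: \mxblock_(i < r, j < r) (if j == ordS i then A (rev_ord i) else 0)
        + l *: \mxdiag_(i < r) C (rev_ord i)) = 0 ->
  exists x : 'I_r -> 'cV[S]_m, (exists i, x i != 0) /\
    forall j, k *: (A j *m x j) + l *: (C j *m x (ordS j)) = 0.
Proof.
set M := _ + _; rewrite -det_tr => /eqP/det0P[v v0 vM].
have {vM} Mu : M *m v^T = 0 by apply: trmx_inj; rewrite trmx_mul trmxK vM trmx0.
move: Mu; rewrite -[v^T]submxcolK.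
set u := fun i => submxcol v^T i => Mu.
(* Block row [rev_ord j] holds [A j] in column [ordS (rev_ord j)] and [C j] on the diagonal. *)
exists (fun j => u (ordS (rev_ord j))); split.
  apply: contrapT => /forallNP u0; case/eqP: v0.
  apply: trmx_inj; rewrite trmx0 -[v^T]submxcolK -[RHS]mxcol0.
  apply: eq_mxcol => i; apply/eqP/negPn/negP => ui; apply: (u0 (rev_ord (ord_pred i))).
  by rewrite rev_ordK ord_predK.
move=> j; move: Mu; rewrite mulmxDl -!scalemxAl mul_mxblock_mxrow mul_mxdiag_mxcol.
move/mxcolP => /(_ (rev_ord j)).
rewrite submxcolD submxcol0 /= => e; rewrite -[RHS]e; congr (_ + _).
  rewrite submxcolZ mxcolK (bigD1 (ordS (rev_ord j))) //= eqxx rev_ordK.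
  by rewrite [X in _ + X]big1 ?addr0 // => i /negPf ->; rewrite mul0mx.
by rewrite submxcolZ mxcolK rev_ordK /= ordS_rev.
Qed.

Lemma cyclic_row_kernel :
  \det (k *: \mxblock_(i < r, j < r) (if j == ordS i then A (rev_ord j) else 0)
        + l *: \mxdiag_(i < r) C (rev_ord i)) = 0 ->
  exists y : 'I_r -> 'rV[S]_m, (exists i, y i != 0) /\
    forall j, k *: (y (ordS j) *m A j) + l *: (y j *m C j) = 0.
Proof.
move=> /eqP/det0P[v v0]; rewrite -[v]submxrowK.
set u := fun i => submxrow v i => vM.
exists (fun j => u (rev_ord j)); split.
  apply: contrapT => /forallNP u0; case/eqP: v0.
  rewrite -[v]submxrowK -[RHS]mxrow0.
  apply: eq_mxrow => i; apply/eqP/negPn/negP => ui; apply: (u0 (rev_ord i)).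
  by rewrite rev_ordK.
move=> j; move: vM; rewrite mulmxDr -!scalemxAr mul_mxrow_mxblock mul_mxrow_mxdiag.
move/mxrowP => /(_ (rev_ord j)).
rewrite submxrowD submxrow0 /= => e; rewrite -[RHS]e; congr (_ + _).
  rewrite submxrowZ mxrowK (bigD1 (rev_ord (ordS j))) //=.
  rewrite ordS_rev eqxx rev_ordK.
  rewrite [X in _ + X]big1 ?addr0 // => i ne; rewrite ifN ?mulmx0 //.
  by apply: contraNneq ne => e'; apply/eqP/ordS_inj; rewrite -e' ordS_rev.
by rewrite submxrowZ mxrowK rev_ordK.
Qed.

End Kernels.

Section Coefficients.
Variables (K : fieldType).

Lemma map_coefp_mul p q s (M : 'M[K]_(p, q)) (x : 'M[{poly K}]_(q, s)) k :
  map_mx (coefp k) (map_mx polyC M *m x) = M *m map_mx (coefp k) x.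
Proof.
apply/matrixP => i j; rewrite !mxE /= coef_sum; apply: eq_bigr => h _.
by rewrite !mxE coefCM.
Qed.

Lemma map_coefp_mulr p q s (x : 'M[{poly K}]_(p, q)) (M : 'M[K]_(q, s)) k :
  map_mx (coefp k) (x *m map_mx polyC M) = map_mx (coefp k) x *m M.
Proof.
apply/matrixP => i j; rewrite !mxE /= coef_sum; apply: eq_bigr => h _.
by rewrite !mxE coefMC.
Qed.

Lemma map_coefpXZ p q (x : 'M[{poly K}]_(p, q)) k :
  map_mx (coefp k) ('X *: x) = if k is k'.+1 then map_mx (coefp k') x else 0.
Proof. by apply/matrixP => i j; case: k => [|k]; rewrite !mxE /= coefXM. Qed.

Lemma map_coefpD p q (x y : 'M[{poly K}]_(p, q)) k :
  map_mx (coefp k) (x + y) = map_mx (coefp k) x + map_mx (coefp k) y.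
Proof. by apply/matrixP => i j; rewrite !mxE /= coefD. Qed.

Lemma map_coefp_bound (I : finType) p q (x : I -> 'M[{poly K}]_(p, q)) :
  exists N, forall i k, (N <= k)%N -> map_mx (coefp k) (x i) = 0.
Proof.
exists (\max_i \max_a \max_b size (x i a b)) => i k Nk.
apply/matrixP => a b; rewrite !mxE /= nth_default //; apply: leq_trans Nk.
apply: leq_trans (leq_bigmax i); apply: leq_trans (leq_bigmax a).
exact: (leq_bigmax b).
Qed.

Lemma map_coefp_neq0 p q (x : 'M[{poly K}]_(p, q)) :
  x != 0 -> exists k, map_mx (coefp k) x != 0.
Proof.
move=> /matrix0Pn[a [b xab]]; exists (size (x a b)).-1.
by apply/matrix0Pn; exists a, b; rewrite !mxE /= -/(lead_coef _) lead_coef_eq0.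
Qed.

Lemma map_mxblock_polyC r m n (A : 'I_r -> 'I_r -> 'M[K]_(m, n)) :
  map_mx polyC (\mxblock_(i, j) A i j) = \mxblock_(i, j) map_mx polyC (A i j).
Proof. by apply/matrixP => i j; rewrite !mxE. Qed.

Lemma map_mxdiag_polyC r m (A : 'I_r -> 'M[K]_m) :
  map_mx polyC (\mxdiag_i A i) = \mxdiag_i map_mx polyC (A i).
Proof.
rewrite /mxdiag map_mxblock_polyC; apply: eq_mxblock => i j.
by case: eqP => _; rewrite ?map_mx0 // !conform_mx_id.
Qed.

End Coefficients.

(** * Chains from singular pencils *)

Section SingularPencils.
Variables (K : fieldType) (r' m : nat).
Local Notation r := r'.+1.
Local Notation pos := (@inZp r').

(** Block index and degree grow together, so the chain follows one diagonal of the pairs (block,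
    degree). *)
Lemma ascending_chain (A C : 'I_r -> 'M[K]_m) (x : 'I_r -> nat -> 'cV[K]_m) (N : nat) :
  (forall j k, (N <= k)%N -> x j k = 0) ->
  (forall j, C j *m x (ordS j) 0%N = 0) ->
  (forall j k, A j *m x j k + C j *m x (ordS j) k.+1 = 0) ->
  (exists i k, x i k != 0) -> has_chain A C.
Proof.
move=> xN x0 rel [i [k xik]].
(* [M + k] is congruent to [i] mod [r], so the diagonal meets [x i k]; the extra [r] makes [M]
   positive, hence a zero term at 0. *)
pose M := (i + k * r' + r)%N.
exists 0%N, (M + N)%N, (fun t => if (M <= t)%N then x (pos t) (t - M)%N else 0).
split.
  split=> [|t tN|t]; first by rewrite ifN // /M; lia.
    by case: ifP => // _; apply: xN; lia.
  rewrite add0n; have [Mt|tM|Mt] := ltngtP M t.+1.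
  - by rewrite (_ : (M <= t)%N) ?subSn // -pos_ordS rel.
  - by rewrite !ifN ?mulmx0 ?addr0 //; lia.
  - rewrite ifN ?mulmx0 ?add0r; last by lia.
    by rewrite Mt subnn -pos_ordS x0.
exists (M + k)%N; rewrite leq_addr addnC addnK (_ : pos _ = i) //.
apply: val_inj; rewrite /= /M.
have -> : (k + (i + k * r' + r) = i + k.+1 * r)%N by lia.
by rewrite addnC modnMDl modn_small.
Qed.

(** Reversing degrees, [k] to [N - k], reduces to the ascending case. *)
Lemma descending_chain (A C : 'I_r -> 'M[K]_m) (x : 'I_r -> nat -> 'cV[K]_m) (N : nat) :
  (forall j k, (N <= k)%N -> x j k = 0) ->
  (forall j, A j *m x j 0%N = 0) ->
  (forall j k, A j *m x j k.+1 + C j *m x (ordS j) k = 0) ->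
  (exists i k, x i k != 0) -> has_chain A C.
Proof.
move=> xN x0 rel [i [k xik]].
have kN : (k <= N)%N by rewrite leqNgt; apply: contra xik => ?; rewrite xN // ltnW.
apply: (@ascending_chain _ _ (fun j k => if (k <= N)%N then x j (N - k)%N else 0) N.+1).
- by move=> j k' Nk'; rewrite ifN //; lia.
- move=> j; rewrite leq0n subn0.
  by have := rel j N; rewrite xN // mulmx0 add0r.
- move=> j k'; have [k'N|k'N|->] := ltngtP k' N.
  + by rewrite -(rel j (N - k'.+1)%N) subnSK.
  + by rewrite !mulmx0 addr0.
  + by rewrite subnn x0 mulmx0 addr0.
- by exists i, (N - k)%N; rewrite leq_subr subKn.
Qed.

Lemma left_singular_chain (A C : 'I_r -> 'M[K]_m) :
  ~ regular (left_pencil A C) -> has_chain A C.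
Proof.
move=> /contrapT; rewrite /pencil_mx /= map_mxblock_polyC map_mxdiag_polyC => det0.
have [|x [[i xi] rel]] := @cyclic_col_kernel _ r m 1 'X
  (fun i => map_mx polyC (A i)) (fun i => map_mx polyC (C i)).
  rewrite -[RHS]det0 scale1r; congr (\det (_ + _)).
  by apply: eq_mxblock => a b; case: eqP; rewrite ?map_mx0.
have [N xN] := map_coefp_bound x.
apply: (@descending_chain _ _ (fun j k => map_mx (coefp k) (x j)) N) => //.
- move=> j; have := congr1 (map_mx (coefp 0)) (rel j).
  by rewrite scale1r map_coefpD map_coefp_mul map_coefpXZ addr0 map_mx0.
- move=> j k; have := congr1 (map_mx (coefp k.+1)) (rel j).
  by rewrite scale1r map_coefpD map_coefp_mul map_coefpXZ map_coefp_mul map_mx0.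
- by have [k xik] := map_coefp_neq0 xi; exists i, k.
Qed.

(** Here lambda multiplies the coefficient of [y j], not that of [y (ordS j)], so the degree rises
    with the index. *)
Lemma right_singular_chain (B D : 'I_r -> 'M[K]_m) :
  ~ regular (right_pencil B D) ->
  has_chain (fun i => (B i)^T) (fun i => (D i)^T).
Proof.
move=> /contrapT; rewrite /pencil_mx /= map_mxblock_polyC map_mxdiag_polyC => det0.
have [|y [[i yi] rel]] := @cyclic_row_kernel _ r m 1 'X
  (fun i => map_mx polyC (D i)) (fun i => map_mx polyC (B i)).
  rewrite -[RHS]det0 scale1r; congr (\det (_ + _)).
  by apply: eq_mxblock => a b; case: eqP; rewrite ?map_mx0.
have [N yN] := map_coefp_bound y.
apply: (@ascending_chain _ _ (fun j k => (map_mx (coefp k) (y j))^T) N).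
- by move=> j k Nk; rewrite yN // trmx0.
- move=> j; rewrite -trmx_mul; have := congr1 (map_mx (coefp 0)) (rel j).
  rewrite scale1r map_coefpD map_coefp_mulr map_coefpXZ addr0 map_mx0 => ->.
  by rewrite trmx0.
- move=> j k; rewrite -!trmx_mul -linearD /=; have := congr1 (map_mx (coefp k.+1)) (rel j).
  rewrite scale1r map_coefpD map_coefp_mulr map_coefpXZ map_coefp_mulr map_mx0.
  by rewrite addrC => ->; rewrite trmx0.
- have [k yik] := map_coefp_neq0 yi; exists i, k.
  by rewrite -trmx0 (inj_eq trmx_inj).
Qed.

End SingularPencils.

(** Lets the results on chains of [A], [C] serve for [B], [D], and those on the eigenvalue 0 for
    infinity. *)
Lemma only_trivial_tr (K : fieldType) r' m n (A C : 'I_r'.+1 -> 'M[K]_m)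
    (B D : 'I_r'.+1 -> 'M[K]_n) :
  only_trivial A C B D ->
  only_trivial (fun i => (B i)^T) (fun i => (D i)^T)
               (fun i => (A i)^T) (fun i => (C i)^T).
Proof.
move=> triv X XP i; apply: trmx_inj; rewrite trmx0.
apply: (triv (fun i => (X i)^T)) => j.
by apply: trmx_inj; rewrite trmx0 -[RHS](XP j) linearB /= !trmx_mul !trmxK !mulmxA.
Qed.

(** * Generalized Sylvester equations over a closed field *)

Section Sylvester.
Variable K : closedFieldType.

Lemma horner_pencil p (P : pencil K p) (l : K) :
  (\det (pencil_mx P)).[l] = \det (pconst P + l *: plin P).
Proof.
rewrite -horner_evalE -det_map_mx; congr (\det _); apply/matrixP => i j.
by rewrite !mxE /= /horner_eval !hornerE.
Qed.

(** By Cayley-Hamilton [X] is killed by a product of factors [H - l%:M]. Multiplying them in one by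
    one keeps the intertwining; the factor that first gives 0 yields [l], since [G - l%:M] then
    kills the last nonzero product. *)
Lemma intertwiner_common_eigenvalue p q (G : 'M[K]_p) (H : 'M[K]_q) (X : 'M[K]_(p, q)) :
  G *m X = X *m H -> X != 0 ->
  exists l, \det (G - l%:M) = 0 /\ \det (H - l%:M) = 0.
Proof.
case: q H X => [|q] H X GX X0; first by rewrite thinmx0 eqxx in X0.
have [s sE] := closed_field_poly_normal (char_poly H).
move: sE; rewrite (monicP (char_poly_monic H)) scale1r => sE.
have: X *m \prod_(l <- s) (H - l%:M) = 0.
  rewrite -[RHS](mulmx0 _ X) -(Cayley_Hamilton H) sE rmorph_prod; congr (_ *m _).
  by apply: eq_bigr => l _; rewrite rmorphB /= horner_mx_X horner_mx_C.
have: {subset s <= root (char_poly H)}.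
  by move=> l ls; rewrite sE -[_ \in _]/(root _ l) root_prod_XsubC.
elim: s {sE} X GX X0 => [|l s IHs] X GX X0 sub; first by rewrite big_nil mulmx1 => /eqP/idPn[].
rewrite big_cons -[_ * _]/(_ *m _) mulmxA.
have [Xl _|Xl] := eqVneq (X *m (H - l%:M)) 0; last first.
  apply: IHs => // [|l' l's]; last by apply: sub; rewrite inE l's orbT.
  by rewrite mulmxA GX -!mulmxA mulmxBr mulmxBl scalar_mxC.
exists l; split.
  apply/eqP/negPn/negP => Gl; case/eqP: X0.
  have Gu : G - l%:M \in unitmx by rewrite unitmxE unitfE.
  rewrite -[X](mulKmx Gu) mulmxBl GX -[l%:M *m X]scalar_mxC -mulmxBr Xl.
  by rewrite mulmx0.
have : root (char_poly H) l by apply: sub; rewrite mem_head.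
rewrite -eigenvalue_root_char => /eigenvalueP[v vH v0].
by apply/eqP/det0P; exists v => //; rewrite mulmxBr vH mul_mx_scalar subrr.
Qed.

(* The Moebius map [l |-> mu - l^-1] takes the eigenvalues of
   [(M + mu N)^-1 N] to those of the pencil [M + lambda N]. *)
Lemma spectrum_shift p (P : pencil K p) (mu l : K) :
  \det (plin P - l *: (pconst P + mu *: plin P)) = 0 ->
  spectrum P (if l == 0 then None else Some (mu - l^-1)).
Proof.
case: eqVneq => [->|l0] /=.
  by rewrite scale0r subr0 unitmxE unitfE negbK => ->.
have -> : plin P - l *: (pconst P + mu *: plin P) =
          - l *: (pconst P + (mu - l^-1) *: plin P).
  rewrite scalerBl addrA scalerBr [- l *: (l^-1 *: _)]scalerA mulNr mulfV //.
  by rewrite scaleN1r opprK scaleNr [RHS]addrC.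
by rewrite detZ => /eqP; rewrite mulf_eq0 expf_eq0 oppr_eq0 (negPf l0) andbF => /eqP.
Qed.

Lemma pencil_sylvester p q (P : pencil K p) (S : pencil K q) (X : 'M[K]_(p, q)) :
  regular P -> regular S -> (spectrum P `&` spectrum S = set0)%classic ->
  pconst P *m X *m plin S = plin P *m X *m pconst S -> X = 0.
Proof.
move=> /eqP regP /eqP regS disj XE; apply/eqP/negPn/negP => X0.
have [mu] : exists mu, ~~ root (\det (pencil_mx P) * \det (pencil_mx S)) mu.
  by apply/closed_nonrootP; rewrite mulf_neq0.
rewrite rootM negb_or !rootE !horner_pencil => /andP[].
rewrite -!unitfE -!unitmxE.
set L := _ + _; set R := _ + _ => Lu Ru.
(* With [Q = plin P] and [T = plin S], adding [mu Q X T] to both sides of [XE] gives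
   [L X T = Q X R]. *)
have key : invmx L *m plin P *m X = X *m (plin S *m invmx R).
  rewrite -mulmxA; apply: (canLR (mulKmx Lu)); rewrite !mulmxA.
  apply: (canRL (mulmxK Ru)); rewrite /L /R mulmxDr !mulmxDl -!scalemxAr.
  by rewrite -!scalemxAl XE.
have [l [Gl Hl]] := intertwiner_common_eigenvalue key X0.
suff : (spectrum P `&` spectrum S)%classic (if l == 0 then None else Some (mu - l^-1)).
  by rewrite disj.
split; apply: spectrum_shift.
  have -> : plin P - l *: (pconst P + mu *: plin P) = L *m (invmx L *m plin P - l%:M).
    by rewrite mulmxBr mulKVmx // mul_mx_scalar.
  by rewrite det_mulmx Gl mulr0.
have -> : plin S - l *: (pconst S + mu *: plin S) = (plin S *m invmx R - l%:M) *m R.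
  by rewrite mulmxBl mulmxKV // mul_scalar_mx.
by rewrite det_mulmx Hl mul0r.
Qed.

End Sylvester.

(** [Y] occupies the transposes of the cyclic positions, so both products are block diagonal, and
    their blocks at [j] are the two sides of the equation [rev_ord j]. *)
Lemma cycle_pencil_eq (K : fieldType) r m n (A C : 'I_r -> 'M[K]_m)
    (B D : 'I_r -> 'M[K]_n) (X : 'I_r -> 'M[K]_(m, n)) :
  sylvester_cycle A C B D X ->
  let Y := \mxblock_(i < r, j < r) (if i == ordS j then X (rev_ord j) else 0) in
  pconst (left_pencil A C) *m Y *m plin (right_pencil B D) =
  plin (left_pencil A C) *m Y *m pconst (right_pencil B D).
Proof.
move=> XE Y; rewrite /= mul_mxblock mul_mxblock_mxdiag mul_mxdiag_mxblock mul_mxblock.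
apply: eq_mxblock => i j.
rewrite (bigD1 (ordS i)) //= eqxx big1 ?addr0; last first.
  by move=> h /negPf ->; rewrite mul0mx.
rewrite (bigD1 (ord_pred j)) //= ord_predK eqxx big1 ?addr0; last first.
  move=> h hj; case: (j =P ordS h) => [e|_]; last by rewrite mulmx0.
  by rewrite e ordSK eqxx in hj.
rewrite (inj_eq (@ordS_inj _)); case: eqVneq => [->|_]; last by rewrite !(mulmx0, mul0mx).
have e : ordS (rev_ord j) = rev_ord (ord_pred j) by rewrite -{1}(ord_predK j) ordS_rev.
by have /eqP := XE (rev_ord j); rewrite subr_eq0 e => /eqP.
Qed.

(** * The criterion *)

Section Main.
Variables (K : closedFieldType) (r' m n : nat).
Local Notation r := r'.+1.
Variables (A C : 'I_r -> 'M[K]_m) (B D : 'I_r -> 'M[K]_n).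

Lemma left_eigenvector (l : K) :
  spectrum (left_pencil A C) (Some l) ->
  exists x : 'I_r -> 'cV[K]_m, (exists i, x i != 0) /\
    forall j, A j *m x j + l *: (C j *m x (ordS j)) = 0.
Proof.
move=> /= det0; have [|x [x0 xP]] := @cyclic_col_kernel _ r m 1 l A C.
  by rewrite scale1r.
by exists x; split=> // j; rewrite -[RHS](xP j) scale1r.
Qed.

Lemma right_eigenvector (l : K) :
  spectrum (right_pencil B D) (Some l) ->
  exists y : 'I_r -> 'rV[K]_n, (exists i, y i != 0) /\
    forall j, y (ordS j) *m D j + l *: (y j *m B j) = 0.
Proof.
move=> /= det0; have [|y [y0 yP]] := @cyclic_row_kernel _ r n 1 l D B.
  by rewrite scale1r.
by exists y; split=> // j; rewrite -[RHS](yP j) scale1r.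
Qed.

Lemma left_singular_infty :
  spectrum (left_pencil A C) None -> exists j, C j \notin unitmx.
Proof.
rewrite /= unitmxE unitfE negbK => /eqP det0.
have [|x [[i xi] xP]] := @cyclic_col_kernel _ r m 0 1 A C.
  by rewrite scale0r add0r scale1r.
exists (ord_pred i); apply: contra xi => Cu.
have := xP (ord_pred i); rewrite scale0r add0r scale1r ord_predK => e.
by rewrite -[x i](mulKmx Cu) e mulmx0.
Qed.

Lemma right_singular_infty :
  spectrum (right_pencil B D) None -> exists j, B j \notin unitmx.
Proof.
rewrite /= unitmxE unitfE negbK => /eqP det0.
have [|y [[i yi] yP]] := @cyclic_row_kernel _ r n 0 1 D B.
  by rewrite scale0r add0r scale1r.
exists i; apply: contra yi => Bu.
have := yP i; rewrite scale0r add0r scale1r => e.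
by rewrite -[y i](mulmxK Bu) e mul0mx.
Qed.

Lemma only_trivialP : (0 < m)%N -> (0 < n)%N ->
  only_trivial A C B D <->
  [/\ regular (left_pencil A C), regular (right_pencil B D) &
      spectrum (left_pencil A C) `&` spectrum (right_pencil B D) = set0].
Proof.
move=> m0 n0; split=> [triv|[regl regr disj] X /cycle_pencil_eq XE i]; last first.
  have /mxblockP/(_ (ordS (rev_ord i)) (rev_ord i)) := pencil_sylvester regl regr disj XE.
  by rewrite mxblockK submxblock0 eqxx rev_ordK.
have trivT := only_trivial_tr triv.
have nol : ~ has_chain A C by move=> ch; exact: chain_nontrivial n0 ch triv.
have nor : ~ has_chain (fun i => (B i)^T) (fun i => (D i)^T).
  by move=> ch; exact: chain_nontrivial m0 ch trivT.
split.
- by apply: contrapT => /left_singular_chain.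
- by apply: contrapT => /right_singular_chain.
apply/seteqP; split=> // -[l|] [Hl Hr]; last first.
  have [j Cj] := left_singular_infty Hl; have [i Bi] := right_singular_infty Hr.
  (* The transposed system puts [B^T] and [C^T] in the roles of [A] and [D], so infinity is handled
     as the eigenvalue 0. *)
  by apply/nor/(@common_zero_chain _ _ _ _ _ _ _ _ i j trivT); rewrite unitmx_tr.
have [x [[i xi] xP]] := left_eigenvector Hl.
have [y [[j yj] yP]] := right_eigenvector Hr.
have [l0|l0] := eqVneq l 0; last first.
  by apply/nol/(common_eigenvalue_chain triv l0 xP yP); [exists i | exists j].
apply/nol/(@common_zero_chain _ _ _ _ _ _ _ _ i (ord_pred j) triv).
  apply: contra xi => Au; have := xP i; rewrite l0 scale0r addr0 => e.
  by rewrite -[x i](mulKmx Au) e mulmx0.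
apply: contra yj => Du; have := yP (ord_pred j); rewrite l0 scale0r addr0 ord_predK => e.
by rewrite -[y j](mulmxK Du) e mul0mx.
Qed.

End Main.

Theorem theorem2 (R : realType) (r m n : nat)
    (hr : (1 < r)%N) (hm : (0 < m)%N) (hn : (0 < n)%N)
    (A C : 'I_r -> 'M[R[i]]_m) (B D : 'I_r -> 'M[R[i]]_n) :
  (forall X : 'I_r -> 'M[R[i]]_(m, n),
      sylvester_cycle A C B D X -> forall i : 'I_r, X i = 0) <->
  [/\ regular (left_pencil A C),
      regular (right_pencil B D) &
      spectrum (left_pencil A C) `&` spectrum (right_pencil B D) = set0].
Proof.
case: r hr A C B D => // r' _ A C B D.
exact: (@only_trivialP R[i] r' m n A C B D hm hn).
Qed.
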